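(* Let $\mathsf{E}$ be a variety, and let $G$ be an object of $\mathsf{E}$ with quotient $Q$ and projection $\pi:G\twoheadrightarrow Q$. There exist categories $\mathsf{A}$ and $\mathsf{B}$, with $\mathsf{E}^{\leftrightarrow}\le\mathsf{A}\le\mathsf{E}$, such that the following are equivalent. (1) $Q$ is a characteristic quotient of $G$. (2) There is a functor $\mathcal{U}:\mathsf{A}\to\mathsf{A}$ and a unit $\epsilon:\mathrm{id}_{\mathsf{A}}\Rightarrow\mathcal{U}$ such that $Q=\mathrm{Coim}(\epsilon_G)$. (3) $G$ is an object of $\mathsf{B}$, $\pi$ is a morphism of $\mathsf{B}$, and there is an $(\mathsf{A},\mathsf{B})$-morphism $\mathcal{M}:\mathsf{A}\to\mathsf{B}$ (with respect to some $(\mathsf{A},\mathsf{B})$-bicapsule structures on $\mathsf{A}$ and on $\mathsf{B}$, where the left action of $\mathsf{A}$ on $\mathsf{A}$ and the right action of $\mathsf{B}$ on $\mathsf{B}$ are regular) such that $\pi=\mathcal{M}(\mathbb{1}_{\mathsf{A}}\cdot\mathrm{id}_G)$.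
   Context: A variety $\mathsf{E}$ is the category of all algebras of a fixed (finitary, single-sorted) signature satisfying a fixed collection of equational laws, with all homomorphisms. $\mathsf{E}^{\leftrightarrow}$ is the subcategory of all objects and all isomorphisms; $\mathsf{X}\le\mathsf{Y}$ means $\mathsf{X}$ is a subcategory of $\mathsf{Y}$. A quotient $\pi:G\twoheadrightarrow Q$ (surjective homomorphism) is characteristic if every automorphism $\varphi$ of $G$ induces an automorphism $\psi$ of $Q$ with $\psi\pi=\pi\varphi$. A unit is a natural transformation $\mathrm{id}_{\mathsf{A}}\Rightarrow\mathcal{U}$. For a homomorphism $\varphi$, $\mathrm{Coim}(\varphi)$ is the quotient of its domain by its kernel congruence; equality of quotients of $G$ is as quotients (i.e. the projections are equivalent). A category is identified with its collection of morphisms with partial composition $fg=f\circ g$. For a morphism $f$, let $s(f)$ and $t(f)$ be the identity morphisms of its domain and codomain; $fg$ is defined iff $s(f)=t(g)$. $\mathbb{1}_{\mathsf{A}}$ denotes the collection of identity morphisms of $\mathsf{A}$. A left action of a category $\mathsf{A}$ on a collection $X$ consists of a collection $\lhd X$, functions $a\mapsto a\lhd$ from $\mathsf{A}$ to $\lhd X$ and $x\mapsto\lhd x$ from $X$ to $\lhd X$, and a partial function $(a,x)\mapsto a\cdot x\in X$ such that: $a\cdot x$ is defined iff $a\lhd=\lhd x$; $s(a)\lhd=a\lhd$, and $s(a)\cdot x=x$ whenever defined; and if $(ab)\cdot x$ is defined then $a\cdot(b\cdot x)$ is defined and equal to it. The action is full if for every $a$ there is $x$ with $a\lhd=\lhd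 x$. A category $\mathsf{X}$ is a left $\mathsf{A}$-capsule if it has a full left $\mathsf{A}$-action (on morphisms) with $\lhd\mathsf{X}=\mathbb{1}_{\mathsf{X}}$, $\lhd x=t(x)$ and $a\cdot(xy)=(a\cdot x)y$. Right actions and right capsules are defined symmetrically. An $(\mathsf{A},\mathsf{B})$-bicapsule is a category $\mathsf{X}$ that is a left $\mathsf{A}$-capsule and a right $\mathsf{B}$-capsule with $a\cdot(x\cdot b)=(a\cdot x)\cdot b$. The left (right) regular action of a category on itself is by composition on the left (right). For a right $\mathsf{B}$-capsule $\mathsf{X}$ and a morphism $b$ of $\mathsf{B}$, there is exactly one $e\in\mathbb{1}_{\mathsf{X}}$ with $e\cdot b$ defined; $\mathbb{1}_{\mathsf{X}}\cdot b$ denotes the element $e\cdot b$. An $(\mathsf{A},\mathsf{B})$-morphism between $(\mathsf{A},\mathsf{B})$-bicapsules $\mathsf{Y}\to\mathsf{X}$ is a partial function $\mathcal{M}$ on morphisms such that, whenever $a\cdot y\cdot b$ is defined, $\mathcal{M}(a\cdot y\cdot b)$ is defined and equals $a\cdot\mathcal{M}(y)\cdot b$. It need not be a functor. *)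

(* Defs.v *)
From mathcomp Require Import all_boot.
From mathcomp Require Import boolp classical_sets.

Set Implicit Arguments.
Unset Strict Implicit.
Unset Printing Implicit Defensive.

Local Open Scope classical_set_scope.

(** * Categories as collections of morphisms

    A category is its collection of morphisms.  Objects are represented by
    identity morphisms, and [src f], [tgt f] are the identities of the domain
    and of the codomain of [f].  Partial functions are [option]-valued; an
    equation between [option]s therefore also says that one side is defined iff
    the other is.  [comp f g] is the composite "f after g". *)

Record category := Category {
  mor :> Type;
  src : mor -> mor;
  tgt : mor -> mor;
  comp : mor -> mor -> option mor;
  src_src : forall f, src (src f) = src f;
  tgt_src : forall f, tgt (src f) = src f;
  src_tgt : forall f, src (tgt f) = tgt f;
  tgt_tgt : forall f, tgt (tgt f) = tgt f;
  comp_defined : forall f g, comp f g <-> src f = tgt g;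
  src_comp : forall f g h, comp f g = Some h -> src h = src g;
  tgt_comp : forall f g h, comp f g = Some h -> tgt h = tgt f;
  comp_src : forall f, comp f (src f) = Some f;
  comp_tgt : forall f, comp (tgt f) f = Some f;
  comp_assoc : forall f g h,
    obind (fun gh => comp f gh) (comp g h) =
    obind (fun fg => comp fg h) (comp f g) }.

Arguments src {c}.
Arguments tgt {c}.
Arguments comp {c}.

Definition identities (C : category) : set C := [set e | src e = e].
Arguments identities : clear implicits.

Definition id_mor (C : category) (e : identities C) : C := val e.

Definition is_iso (C : category) (f : C) :=
  exists g : C, comp g f = Some (src f) /\ comp f g = Some (tgt f).

Record functor (C D : category) := Functor {
  fmor :> C -> D;
  fsrc : forall f, fmor (src f) = src (fmor f);
  ftgt : forall f, fmor (tgt f) = tgt (fmor f);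
  fcomp : forall f g h, comp f g = Some h -> comp (fmor f) (fmor g) = Some (fmor h) }.

Definition id_functor (C : category) : functor C C :=
  @Functor C C id (fun _ => erefl) (fun _ => erefl) (fun _ _ _ => id).
Arguments id_functor : clear implicits.

Lemma src_identity (C : category) (f : C) : src f \in identities C.
Proof. by apply/mem_set; exact: src_src. Qed.

Lemma tgt_identity (C : category) (f : C) : tgt f \in identities C.
Proof. by apply/mem_set; exact: src_tgt. Qed.

Definition src_id (C : category) (f : C) : identities C := SigSub (src_identity f).
Definition tgt_id (C : category) (f : C) : identities C := SigSub (tgt_identity f).

Record nat_trans (C D : category) (F G : functor C D) := NatTrans {
  component :> identities C -> D;
  src_component : forall e, src (component e) = F (id_mor e);
  tgt_component : forall e, tgt (component e) = G (id_mor e);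
  naturality : forall f : C,
    comp (component (tgt_id f)) (F f) = comp (G f) (component (src_id f)) }.

Record subcategory (C : category) := Subcategory {
  sub_mor : set C;
  sub_src : forall f, sub_mor f -> sub_mor (src f);
  sub_tgt : forall f, sub_mor f -> sub_mor (tgt f);
  sub_comp : forall f g h, sub_mor f -> sub_mor g -> comp f g = Some h -> sub_mor h }.

Section SubcategoryCategory.
Variables (C : category) (S : subcategory C).
Let T : Type := sub_mor S.

Definition subcat_src (f : T) : T := SigSub (mem_set (sub_src (set_mem (valP f)))).
Definition subcat_tgt (f : T) : T := SigSub (mem_set (sub_tgt (set_mem (valP f)))).
Definition subcat_comp (f g : T) : option T := obind insub (comp (val f) (val g)).

Lemma subcat_compE (f g : T) : omap val (subcat_comp f g) = comp (val f) (val g).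
Proof.
rewrite /subcat_comp; case E: (comp _ _) => [h|] //=.
rewrite insubT //; apply/mem_set.
exact: sub_comp (set_mem (valP f)) (set_mem (valP g)) E.
Qed.

Lemma omap_val_inj (x y : option T) : omap val x = omap val y -> x = y.
Proof. by case: x y => [x|] [y|] //= [] /val_inj ->. Qed.

Definition subcat : category.
Proof.
refine (@Category T subcat_src subcat_tgt subcat_comp _ _ _ _ _ _ _ _ _ _).
- by move=> f; apply/val_inj/src_src.
- by move=> f; apply/val_inj/tgt_src.
- by move=> f; apply/val_inj/src_tgt.
- by move=> f; apply/val_inj/tgt_tgt.
- move=> f g; have := comp_defined (val f) (val g).
  rewrite -subcat_compE; case: (subcat_comp f g) => [h|] /= H; split => //.
  + by move=> _; apply/val_inj/H.
  + by move=> /(congr1 val)/H.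
- move=> f g h /(congr1 (omap val)); rewrite subcat_compE => /src_comp E.
  exact/val_inj.
- move=> f g h /(congr1 (omap val)); rewrite subcat_compE => /tgt_comp E.
  exact/val_inj.
- by move=> f; apply/omap_val_inj; rewrite subcat_compE comp_src.
- by move=> f; apply/omap_val_inj; rewrite subcat_compE comp_tgt.
- move=> f g h; apply/omap_val_inj.
  have := comp_assoc (val f) (val g) (val h); rewrite -!subcat_compE.
  by case: (subcat_comp g h) => [gh|]; case: (subcat_comp f g) => [fg|] //=;
    rewrite -?subcat_compE.
Defined.

End SubcategoryCategory.

Coercion subcat : subcategory >-> category.

Definition incl (C : category) (S : subcategory C) (f : S) : C := val f.

(** * Actions, capsules, bicapsules

    The type [I] is the collection written "lhd X" (resp. "X rhd"), [lidx a] is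
    "a lhd" and [lpos x] is "lhd x". *)

Record left_action (A : category) (X I : Type) := LeftAction {
  lidx : A -> I;
  lpos : X -> I;
  lact : A -> X -> option X;
  lact_defined : forall a x, lact a x <-> lidx a = lpos x;
  lidx_src : forall a, lidx (src a) = lidx a;
  lact_src : forall a x, lact (src a) x -> lact (src a) x = Some x;
  lact_comp : forall a b ab x, comp a b = Some ab -> lact ab x ->
    obind (fun bx => lact a bx) (lact b x) = lact ab x }.

Record right_action (B : category) (X I : Type) := RightAction {
  ridx : B -> I;
  rpos : X -> I;
  ract : X -> B -> option X;
  ract_defined : forall x b, ract x b <-> rpos x = ridx b;
  ridx_tgt : forall b, ridx (tgt b) = ridx b;
  ract_tgt : forall x b, ract x (tgt b) -> ract x (tgt b) = Some x;
  ract_comp : forall a b ab x, comp a b = Some ab -> ract x ab ->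
    obind (fun xa => ract xa b) (ract x a) = ract x ab }.

Record left_capsule (A X : category) := LeftCapsule {
  lcaps :> left_action A X (identities X);
  lcaps_full : forall a : A, exists x : X, lidx lcaps a = lpos lcaps x;
  lcaps_pos : forall x : X, lpos lcaps x = tgt_id x;
  lcaps_comp : forall (a : A) (x y : X),
    obind (fun xy => lact lcaps a xy) (comp x y) =
    obind (fun ax => comp ax y) (lact lcaps a x) }.

Record right_capsule (B X : category) := RightCapsule {
  rcaps :> right_action B X (identities X);
  rcaps_full : forall b : B, exists x : X, rpos rcaps x = ridx rcaps b;
  rcaps_pos : forall x : X, rpos rcaps x = src_id x;
  rcaps_comp : forall (b : B) (x y : X),
    obind (fun xy => ract rcaps xy b) (comp x y) =
    obind (fun yb => comp x yb) (ract rcaps y b) }.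

Record bicapsule (A B X : category) := Bicapsule {
  bleft : left_capsule A X;
  bright : right_capsule B X;
  bassoc : forall (a : A) (x : X) (b : B),
    obind (fun xb => lact bleft a xb) (ract bright x b) =
    obind (fun ax => ract bright ax b) (lact bleft a x) }.

Definition left_regular (A : category) (c : left_capsule A A) :=
  forall a x : A, lact c a x = comp a x.

Definition right_regular (B : category) (c : right_capsule B B) :=
  forall x b : B, ract c x b = comp x b.

Definition biact (A B X : category) (c : bicapsule A B X) (a : A) (x : X) (b : B)
    : option X :=
  obind (fun ax => ract (bright c) ax b) (lact (bleft c) a x).

Definition bimorphism (A B Y X : category) (cY : bicapsule A B Y)
    (cX : bicapsule A B X) (M : Y -> option X) :=
  forall a y b z, biact cY a y b = Some z ->
    exists2 x, M z = Some x & obind (fun my => biact cX a my b) (M y) = Some x.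

(** The element "1_X . b": the identity [e] of [X] with [e . b] defined is
    [ridx c b] (lemma [one_ract_unique]). *)
Definition one_ract (B X : category) (c : right_capsule B X) (b : B) : option X :=
  ract c (id_mor (ridx c b)) b.

Lemma one_ract_unique (B X : category) (c : right_capsule B X) (b : B)
    (e : identities X) : ract c (id_mor e) b <-> e = ridx c b.
Proof.
rewrite ract_defined rcaps_pos.
suff -> : src_id (id_mor e) = e by [].
exact/val_inj/(set_mem (valP e)).
Qed.

(** * Varieties *)

Record signature := Signature {
  op : Type;
  arity : op -> nat }.

Inductive term (S : signature) : Type :=
  | Var of nat
  | App (o : op S) of ('I_(arity o) -> term S).

Fixpoint eval (S : signature) (X : Type)
    (opX : forall o : op S, ('I_(arity o) -> X) -> X) (env : nat -> X)
    (t : term S) : X :=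
  match t with
  | Var n => env n
  | App o args => opX o (fun i => eval opX env (args i))
  end.

Record variety := Variety {
  sig :> signature;
  law : term sig -> term sig -> Prop }.

(** Algebras may be empty when the signature has no constants. *)
Record algebra (V : variety) := Algebra {
  carrier :> Type;
  aop : forall o : op V, ('I_(arity o) -> carrier) -> carrier;
  alaw : forall t u, law t u -> forall env, eval aop env t = eval aop env u }.

Record hom (V : variety) (X Y : algebra V) := Hom {
  hfun :> X -> Y;
  homM : forall (o : op V) (args : 'I_(arity o) -> X),
    hfun (aop args) = aop (fun i => hfun (args i)) }.

Section Homs.
Variable V : variety.
Implicit Types X Y Z : algebra V.

Lemma hom_eq X Y (f g : hom X Y) : f =1 g -> f = g.
Proof.
case: f g => [f fM] [g gM] /= /funext E; move: fM gM; rewrite E => fM gM.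
by congr Hom.
Qed.

Definition hom_id X : hom X X := @Hom V X X id (fun _ _ => erefl).

Lemma hom_compM X Y Z (f : hom Y Z) (g : hom X Y) (o : op V)
    (args : 'I_(arity o) -> X) :
  f (g (aop args)) = aop (fun i => f (g (args i))).
Proof. by rewrite !homM. Qed.

Definition hom_comp X Y Z (f : hom Y Z) (g : hom X Y) : hom X Z :=
  @Hom V X Z (fun x => f (g x)) (hom_compM f g).

End Homs.

(** * The category of all algebras of a variety *)

Record arrow (V : variety) := Arrow {
  dom : algebra V;
  cod : algebra V;
  arr_hom : hom dom cod }.

Section CategoryOfAlgebras.
Variable V : variety.

Definition id_arrow (X : algebra V) : arrow V := Arrow (hom_id X).

Definition arrow_comp (f g : arrow V) : option (arrow V) :=
  if pselect (cod g = dom f) is left e then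
    Some (Arrow (hom_comp (arr_hom f) (eq_rect _ (hom (dom g)) (arr_hom g) _ e)))
  else None.

Lemma arrow_compE (X Y Z : algebra V) (f : hom Y Z) (g : hom X Y) :
  arrow_comp (Arrow f) (Arrow g) = Some (Arrow (hom_comp f g)).
Proof.
rewrite /arrow_comp /=; case: pselect => // e.
by rewrite (Prop_irrelevance e erefl).
Qed.

Lemma arrow_compN (f g : arrow V) : cod g <> dom f -> arrow_comp f g = None.
Proof. by rewrite /arrow_comp; case: pselect. Qed.

Definition variety_category : category.
Proof.
refine (@Category (arrow V) (fun f => id_arrow (dom f)) (fun f => id_arrow (cod f))
  arrow_comp _ _ _ _ _ _ _ _ _ _) => //=.
- move=> [Y Z f] [X Y' g] /=; split.
  + by rewrite /arrow_comp; case: pselect => //= ->.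
  + move=> /(congr1 (@dom V)) /= E; move: f g; rewrite E => f g.
    by rewrite arrow_compE.
- move=> [Y Z f] [X Y' g] h; rewrite /arrow_comp /=.
  by case: pselect => // e [<-].
- move=> [Y Z f] [X Y' g] h; rewrite /arrow_comp /=.
  by case: pselect => // e [<-].
- move=> [X Y f]; rewrite arrow_compE; congr (Some (Arrow _)).
  exact: hom_eq.
- move=> [X Y f]; rewrite arrow_compE; congr (Some (Arrow _)).
  exact: hom_eq.
- move=> [Z W f] [Y Z' g] [X Y' h].
  have [e1|n1] := pselect (Z' = Z); have [e2|n2] := pselect (Y' = Y).
  + move: f g h; rewrite -e1 -e2 => f g h.
    rewrite !arrow_compE /= !arrow_compE; congr (Some (Arrow _)).
    exact: hom_eq.
  + rewrite (@arrow_compN (Arrow g) (Arrow h)) //=.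
    by move: f; rewrite -e1 => f; rewrite arrow_compE /= arrow_compN.
  + rewrite (@arrow_compN (Arrow f) (Arrow g)) //=.
    by move: h; rewrite e2 => h; rewrite arrow_compE /= arrow_compN.
  + by rewrite !arrow_compN.
Defined.

End CategoryOfAlgebras.

(** * Quotients *)

Record congruence (V : variety) (X : algebra V) := Congruence {
  crel :> X -> X -> Prop;
  crefl : forall x, crel x x;
  csym : forall x y, crel x y -> crel y x;
  ctrans : forall y x z, crel x y -> crel y z -> crel x z;
  cop : forall (o : op V) (a b : 'I_(arity o) -> X),
    (forall i, crel (a i) (b i)) -> crel (aop a) (aop b) }.

(** The elements of the quotient algebra are the equivalence classes; an
    operation is computed on representatives picked by choice. *)
Section QuotientAlgebra.
Variables (V : variety) (X : algebra V) (R : congruence X).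

Definition quot_carrier := {C : X -> Prop | exists x, C = R x}.

Definition quot_class (x : X) : quot_carrier := exist _ (R x : X -> Prop) (ex_intro _ x erefl).

Definition quot_repr (c : quot_carrier) : X := sval (cid (svalP c)).

Lemma quot_class_eq (x y : X) : quot_class x = quot_class y <-> R x y.
Proof.
split=> [/(congr1 sval)/= -> | Rxy]; first exact: crefl.
apply: eq_exist; apply/funext => z; apply/propext; split=> H.
  exact: ctrans (csym Rxy) H.
exact: ctrans Rxy H.
Qed.

Lemma quot_reprK (c : quot_carrier) : quot_class (quot_repr c) = c.
Proof.
case: c => C HC; apply: eq_exist; rewrite /quot_repr /=.
by case: cid => x /= ->.
Qed.

Definition quot_op (o : op V) (args : 'I_(arity o) -> quot_carrier) : quot_carrier :=
  quot_class (aop (fun i => quot_repr (args i))).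

Lemma quot_classM (o : op V) (args : 'I_(arity o) -> X) :
  quot_class (aop args) = quot_op (fun i => quot_class (args i)).
Proof.
apply/quot_class_eq; apply: cop => i; apply/quot_class_eq.
by rewrite quot_reprK.
Qed.

Lemma quot_eval (env : nat -> quot_carrier) (t : term V) :
  eval quot_op env t =
  quot_class (eval (@aop V X) (fun n => quot_repr (env n)) t).
Proof.
elim: t => [n|o args IH] /=; first by rewrite quot_reprK.
by rewrite quot_classM; congr quot_op; apply/funext => i; exact: IH.
Qed.

Lemma quot_law (t u : term V) :
  law t u -> forall env, eval quot_op env t = eval quot_op env u.
Proof. by move=> E env; rewrite !quot_eval (alaw E). Qed.

Definition quot_algebra : algebra V := Algebra quot_law.

Definition quot_proj : hom X quot_algebra :=
  @Hom V X quot_algebra quot_class quot_classM.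

End QuotientAlgebra.

Section Coimage.
Variables (V : variety) (X Y : algebra V) (f : hom X Y).

Definition ker_congruence : congruence X.
Proof.
refine (@Congruence V X (fun x y => f x = f y) _ _ _ _) => //.
- by move=> y x z -> ->.
- by move=> o a b E; rewrite !homM; congr aop; apply/funext.
Defined.

Definition coim : algebra V := quot_algebra ker_congruence.
Definition coim_proj : hom X coim := quot_proj ker_congruence.

End Coimage.

(** Equality of the quotients with projections [p] and [q]; it forces [p] and
    [q] to have the same domain. *)
Definition same_quotient (V : variety) (p q : variety_category V) :=
  exists2 theta : variety_category V, is_iso theta & comp theta p = Some q.

Definition surjective (X Y : Type) (f : X -> Y) := forall y, exists x, f x = y.

Definition is_automorphism (V : variety) (X : algebra V) (phi : hom X X) :=
  is_iso (Arrow phi : variety_category V).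

Definition is_characteristic (V : variety) (G Q : algebra V) (pi : hom G Q) :=
  forall phi : hom G G, is_automorphism phi ->
    exists2 psi : hom Q Q, is_automorphism psi & hom_comp psi pi = hom_comp pi phi.

(* Main.v *)
(** For a surjection [pi] from [G], let [eta X : X -> T X] be [pi] when [X = G],
    and otherwise the quotient of [X] by the intersection of the kernels of
    [pi t] over the isomorphisms [t : X -> G].  Take [A = B] to be the
    subcategory generated by the isomorphisms and all the [eta X].  If [pi] is
    characteristic then [eta] is natural for isomorphisms, and it is natural for
    the generators [eta X] because one may put [T (eta X) = eta (T X)]; so [T]
    is a functor on [A] with unit [eta].  A unit [eta] of [T] gives the
    bimorphism [x |-> eta x], where [A] acts on the left of [B] through [T] and
    all the other actions are regular.  Conversely, a unit or a bimorphism
    forces [ker pi] to be invariant under automorphisms of [G]. *)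

From mathcomp Require Import all_boot.
From mathcomp Require Import boolp classical_sets.
Require Import Defs.

Set Implicit Arguments.
Unset Strict Implicit.
Unset Printing Implicit Defensive.

(** * Identities and composites in a category and in its subcategories *)

Lemma src_id_identity (C : category) (e : identities C) : src_id (id_mor e) = e.
Proof. exact/val_inj/(set_mem (valP e)). Qed.

Lemma tgt_identityE (C : category) (e : C) : src e = e -> tgt e = e.
Proof. by move=> <-; rewrite tgt_src. Qed.

Lemma tgt_id_identity (C : category) (e : identities C) : tgt_id (id_mor e) = e.
Proof. exact/val_inj/tgt_identityE/(set_mem (valP e)). Qed.

Lemma compP (C : category) (f g : C) :
  src f = tgt g -> exists h, comp f g = Some h.
Proof. by move=> /comp_defined; case: (comp f g) => // h _; exists h. Qed.

Lemma comp_srcs (C : category) (f g h : C) : comp f g = Some h -> src f = tgt g.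
Proof. by move=> E; apply/comp_defined; rewrite E. Qed.

Lemma incl_inj (C : category) (S : subcategory C) : injective (@incl C S).
Proof. exact: val_inj. Qed.

Lemma incl_comp (C : category) (S : subcategory C) (f g : S) :
  omap (@incl C S) (comp f g) = comp (incl f) (incl g).
Proof. exact: subcat_compE. Qed.

Lemma incl_comp_eq (C : category) (S : subcategory C) (f g h : S) :
  comp f g = Some h <-> comp (incl f) (incl g) = Some (incl h).
Proof.
rewrite -incl_comp; split=> [->//|].
by case: (comp f g) => [k|] //= /Some_inj/incl_inj ->.
Qed.

(** * Bicapsules obtained from functors, and bimorphisms between them *)

Section CapsulesOfFunctors.
Variables (A X : category) (F : functor A X).

(** With [F] the identity functor this is the left regular action. *)
Definition functor_left_action : left_action A X (identities X).
Proof.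
refine (@LeftAction A X (identities X) (fun a => src_id (F a)) (@tgt_id X)
  (fun a x => comp (F a) x) _ _ _ _).
- move=> a x; rewrite comp_defined; split=> [E|/(congr1 val)//]; exact/val_inj.
- by move=> a; apply/val_inj; rewrite /= fsrc src_src.
- by move=> a x /comp_defined; rewrite fsrc src_src => ->; rewrite comp_tgt.
- by move=> a b ab x /fcomp E _; rewrite comp_assoc E.
Defined.

Definition functor_left_capsule : left_capsule A X.
Proof.
refine (@LeftCapsule A X functor_left_action _ _ _) => //=.
- by move=> a; exists (src (F a)); apply/val_inj; rewrite /= tgt_src.
- by move=> a x y; rewrite comp_assoc.
Defined.

Definition functor_right_action : right_action A X (identities X).
Proof.
refine (@RightAction A X (identities X) (fun a => tgt_id (F a)) (@src_id X)
  (fun x a => comp x (F a)) _ _ _ _).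
- move=> x a; rewrite comp_defined; split=> [E|/(congr1 val)//]; exact/val_inj.
- by move=> a; apply/val_inj; rewrite /= ftgt tgt_tgt.
- by move=> x a /comp_defined; rewrite ftgt tgt_tgt => <-; rewrite comp_src.
- by move=> a b ab x /fcomp E _; rewrite -comp_assoc E.
Defined.

Definition functor_right_capsule : right_capsule A X.
Proof.
refine (@RightCapsule A X functor_right_action _ _ _) => //=.
- by move=> a; exists (tgt (F a)); apply/val_inj; rewrite /= src_tgt.
- by move=> a x y; rewrite comp_assoc.
Defined.

End CapsulesOfFunctors.

Definition functor_bicapsule (A B X : category) (F : functor A X) (H : functor B X) :
  bicapsule A B X.
Proof.
refine (@Bicapsule A B X (functor_left_capsule F) (functor_right_capsule H) _).
by move=> a x b /=; rewrite comp_assoc.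
Defined.

(** The unit is extended from identities to all morphisms by precomposing with [x]. Naturality at
    [a] turns [eps (tgt a) a y b] into [U a (eps (tgt y) y) b]; the rest is associativity. *)
Lemma unit_bimorphism (C : category) (U : functor C C)
    (eps : nat_trans (id_functor C) U) :
  bimorphism (functor_bicapsule (id_functor C) (id_functor C))
    (functor_bicapsule U (id_functor C)) (fun x => comp (eps (tgt_id x)) x).
Proof.
move=> a y b z; rewrite /biact /=.
case Eay: (comp a y) => [ay|] //= Ez.
have tgtz : tgt_id z = tgt_id a.
  by apply/val_inj; rewrite /= (tgt_comp Ez) (tgt_comp Eay).
have srca : src_id a = tgt_id y by apply/val_inj; exact: comp_srcs Eay.
have epsD (f : C) : exists h, comp (eps (tgt_id f)) f = Some h.
  by apply: compP; rewrite src_component.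
have [x Ex] := epsD z; exists x => //.
have [my Emy] := epsD y; rewrite Emy /=.
have [ea Eea] := epsD a; have := naturality eps a; rewrite /= Eea => Enat.
have := comp_assoc (eps (tgt_id a)) a y; rewrite Eea Eay /= => Eeay.
have := comp_assoc (U a) (eps (src_id a)) y; rewrite srca in Enat *.
rewrite -Enat Emy /= -Eeay => ->.
have := comp_assoc (eps (tgt_id a)) ay b; rewrite Ez /= -tgtz Ex.
by move=> <-.
Qed.

Lemma bimorphism_of_unit (C : category) (U : functor C C)
    (eps : nat_trans (id_functor C) U) (e : identities C) :
  exists (cA cB : bicapsule C C C) (M : C -> option C),
    left_regular (bleft cA) /\ right_regular (bright cB) /\
    bimorphism cA cB M /\
    obind M (one_ract (bright cA) (id_mor e)) = Some (eps e).
Proof.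
exists (functor_bicapsule (id_functor C) (id_functor C)).
exists (functor_bicapsule U (id_functor C)).
exists (fun x => comp (eps (tgt_id x)) x); do 3!split=> //.
  exact: unit_bimorphism.
rewrite /one_ract /= comp_tgt /= tgt_id_identity.
by rewrite -[RHS]comp_src src_component.
Qed.

(* Writing [e] for the identity [1_A . g] of [A], the element [y = e . phi] is an
   endomorphism of [e]; evaluating [M] at [y = y . e . g] and at [y = e . e . phi]
   yields [y . p = p phi], and [y . p = (y . tgt p) p] by the capsule law. *)
Lemma bimorphism_intertwines (A B : category) (cA : bicapsule A B A)
    (cB : bicapsule A B B) (M : A -> option B) (g p phi : B) :
  left_regular (bleft cA) -> right_regular (bright cB) -> bimorphism cA cB M ->
  obind M (one_ract (bright cA) g) = Some p ->
  src phi = g -> tgt phi = g -> exists psi, comp psi p = comp p phi.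
Proof.
move=> regA regB bimM + sphi tphi.
have idg : src g = g by rewrite -sphi src_src.
have tg := tgt_identityE idg.
rewrite /one_ract; set e := id_mor _.
have ide : src e = e by exact: (set_mem (valP (ridx (bright cA) g))).
have te := tgt_identityE ide.
have srce : src_id e = ridx (bright cA) g by exact: src_id_identity.
have eg : ract (bright cA) e g = Some e.
  have := @ract_tgt _ _ _ (bright cA) e g; rewrite tg; apply.
  by apply/ract_defined; rewrite rcaps_pos.
rewrite eg /= => Mep.
have [y ephi] : exists y, ract (bright cA) e phi = Some y.
  case E: (ract (bright cA) e phi) => [y|]; first by exists y.
  suff: ract (bright cA) e phi by rewrite E.
  by apply/ract_defined; rewrite rcaps_pos srce -tphi ridx_tgt.
have yg : ract (bright cA) y g = Some y.
  have := @ract_comp _ _ _ (bright cA) phi g phi e.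
  by rewrite ephi /=; apply=> //; rewrite -sphi comp_src.
have sy : src y = e.
  have : ract (bright cA) y g by rewrite yg.
  by move/ract_defined; rewrite rcaps_pos -srce => /(congr1 val) /= ->.
have ee : comp e e = Some e by rewrite -{2}ide comp_src.
have ye : comp y e = Some y by rewrite -sy comp_src.
have [x Mx] : exists2 x, M y = Some x & comp p phi = Some x.
  have [] := bimM e e phi y; first by rewrite /biact regA ee.
  move=> x Mx; rewrite Mep /biact /=.
  case E: (lact _ e p) => [p'|] //=; rewrite regB => Ex; exists x => //.
  by have := @lact_src _ _ _ (bleft cB) e p; rewrite ide E => /(_ isT) [<-].
move=> Ex.
have [] := bimM y e g y; first by rewrite /biact regA ye.
move=> x'; rewrite Mx => -[<-]; rewrite Mep /biact /=.
case yp: (lact _ y p) => [p'|] //=; rewrite regB => p'g.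
have p'x : p' = x.
  by have := comp_srcs p'g; rewrite tg => sp'; move: p'g; rewrite -sp' comp_src => -[].
have := lcaps_comp (bleft cB) y (tgt p) p; rewrite comp_tgt /= yp p'x.
case: (lact _ y (tgt p)) => [psi|] //= E.
by exists psi; rewrite -E Ex.
Qed.

(** * Isomorphisms, factorisations and kernels of homomorphisms *)

Section Homomorphisms.
Variable V : variety.
Implicit Types X Y Z : algebra V.

Lemma hom_congr X Y (f g : hom X Y) : f = g -> forall x, f x = g x.
Proof. by move=> ->. Qed.

Lemma Arrow_inj X Y : injective (fun f : hom X Y => Arrow f).
Proof.
move=> f g E.
have homE (h : arrow V) (e1 : dom h = X) (e2 : cod h = Y) :
    h = Arrow (eq_rect _ (hom X) (eq_rect _ (fun Z => hom Z (cod h)) (arr_hom h) _ e1) _ e2).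
  by case: h e1 e2 => D C h /= e1 e2; subst.
(* A cast from arrows back to [hom X Y], with [f] as default value. On [Arrow h] both casts are
   along proofs of reflexive equalities, so proof irrelevance makes them trivial. *)
pose tr (h : arrow V) : hom X Y :=
  match pselect (dom h = X), pselect (cod h = Y) with
  | left e1, left e2 =>
    eq_rect _ (hom X) (eq_rect _ (fun Z => hom Z (cod h)) (arr_hom h) _ e1) _ e2
  | _, _ => f
  end.
have trE h : tr (Arrow h) = h.
  rewrite /tr /=; case: pselect => // e1; case: pselect => // e2.
  by rewrite (Prop_irrelevance e1 erefl) (Prop_irrelevance e2 erefl).
by rewrite -[f]trE E trE.
Qed.

Lemma arrow_comp_cod (f g h : arrow V) : arrow_comp f g = Some h -> cod g = dom f.
Proof. by rewrite /arrow_comp; case: pselect. Qed.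

(** The endpoints of the inverse arrow are known only as equations, read off from composability;
    substituting them gives a typed inverse. *)
Lemma is_isoP X Y (f : hom X Y) :
  is_iso (Arrow f : variety_category V) <->
  exists g : hom Y X, hom_comp g f = hom_id X /\ hom_comp f g = hom_id Y.
Proof.
split=> [[[Y' X' g]]|[g [gf fg]]]; last first.
  by exists (Arrow g); rewrite /= !arrow_compE gf fg.
move=> [gf fg].
have e1 : Y = Y' by have /(congr1 (@dom V)) := comp_srcs gf.
have e2 : X = X' by have /(congr1 (@dom V)) := comp_srcs fg.
subst Y' X'; move: gf fg; rewrite /= !arrow_compE.
by move=> /Some_inj/Arrow_inj gf /Some_inj/Arrow_inj fg; exists g.
Qed.

Lemma is_iso_id X : is_iso (id_arrow X : variety_category V).
Proof. by apply/is_isoP; exists (hom_id X); split; exact: hom_eq. Qed.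

Lemma is_iso_comp X Y Z (f : hom Y Z) (g : hom X Y) :
  is_iso (Arrow f : variety_category V) -> is_iso (Arrow g : variety_category V) ->
  is_iso (Arrow (hom_comp f g) : variety_category V).
Proof.
move=> /is_isoP[f' [f'f ff']] /is_isoP[g' [g'g gg']]; apply/is_isoP.
exists (hom_comp g' f'); split; apply: hom_eq => x /=.
  by rewrite [f' _](hom_congr f'f _) [LHS](hom_congr g'g _).
by rewrite [g _](hom_congr gg' _) [LHS](hom_congr ff' _).
Qed.

Lemma surj_cancel X Y Z (p : hom X Y) (f g : hom Y Z) :
  surjective p -> hom_comp f p = hom_comp g p -> f = g.
Proof.
move=> ps E; apply: hom_eq => y; have [x <-] := ps y.
exact: hom_congr E x.
Qed.

Lemma surj_factor X Y Z (p : hom X Y) (f : hom X Z) :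
  surjective p -> (forall x x', p x = p x' -> f x = f x') ->
  exists h : hom Y Z, hom_comp h p = f.
Proof.
(* The section [s] need not be a homomorphism; [f] composed with [s] is one, since [f] takes a
   single value on each fibre of [p]. *)
move=> ps pf; pose s y := sval (cid (ps y)).
have sK y : p (s y) = y by exact: (svalP (cid (ps y))).
have hM o (args : 'I_(arity o) -> Y) : f (s (aop args)) = aop (fun i => f (s (args i))).
  rewrite -homM; apply: pf; rewrite sK homM; congr aop.
  by apply/funext => i; rewrite sK.
by exists (@Hom V Y Z (fun y => f (s y)) hM); apply: hom_eq => x /=; apply: pf; rewrite sK.
Qed.

(** Invariance of the kernel only yields an endomorphism induced by [phi]. Its inverse is the one
    induced by the inverse automorphism, as [p] can be cancelled. *)
Lemma characteristic_of_ker X Y (p : hom X Y) : surjective p ->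
  (forall phi : hom X X, is_automorphism phi ->
     forall x x', p x = p x' -> p (phi x) = p (phi x')) ->
  is_characteristic p.
Proof.
move=> ps pker phi phi_aut.
have lift (a : hom X X) (a_aut : is_automorphism a) :
    exists b : hom Y Y, hom_comp b p = hom_comp p a.
  apply: surj_factor => // x x' E; exact: pker E.
have [/= a [aphi phia]] := (is_isoP phi).1 phi_aut.
have [psi Epsi] := lift phi phi_aut.
have [b Eb] : exists b : hom Y Y, hom_comp b p = hom_comp p a.
  by apply: lift; apply/is_isoP; exists phi.
exists psi => //; apply/is_isoP; exists b.
split; apply: (surj_cancel ps); apply: hom_eq => x /=.
  have /= -> := hom_congr Epsi x; have /= -> := hom_congr Eb (phi x).
  by have /= -> := hom_congr aphi x.
have /= -> := hom_congr Eb x; have /= -> := hom_congr Epsi (a x).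
by have /= -> := hom_congr phia x.
Qed.

(** Two surjections with the same kernel factor through each other, and cancelling them shows that
    the factors are mutually inverse. *)
Lemma same_quotient_coim X Y (p : hom X Y) :
  surjective p -> same_quotient (Arrow p) (Arrow (coim_proj p)).
Proof.
move=> ps.
have cs : surjective (coim_proj p).
  by move=> c; exists (quot_repr c); exact: quot_reprK.
have [f fE] : exists f, hom_comp f p = coim_proj p.
  by apply: surj_factor => // x x' E; apply/quot_class_eq.
have [g gE] : exists g, hom_comp g (coim_proj p) = p.
  by apply: surj_factor => // x x' /quot_class_eq.
exists (Arrow f); last by rewrite /= arrow_compE fE.
apply/is_isoP; exists g; split.
  apply: (surj_cancel ps); apply: hom_eq => x /=.
  by have /= -> := hom_congr fE x; have /= -> := hom_congr gE x.
apply: (surj_cancel cs); apply: hom_eq => x /=.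
by have /= -> := hom_congr gE x; have /= -> := hom_congr fE x.
Qed.

Lemma same_quotient_ker X Y Z (p : hom X Y) (q : hom X Z) :
  same_quotient (Arrow p) (Arrow q) -> forall x x', p x = p x' <-> q x = q x'.
Proof.
move=> [[Y' Z' t] + tp].
have e1 : Y = Y' by have /(congr1 (@dom V)) := comp_srcs tp.
have e2 : Z = Z' by have /(congr1 (@dom V)) := tgt_comp tp.
subst Y' Z'; move: tp; rewrite /= arrow_compE => /Some_inj/Arrow_inj <-.
move=> /is_isoP[t' [t't _]] x x' /=; split=> [->//|].
move=> /(congr1 t').
have tK y : t' (t y) = y by exact: hom_congr t't y.
by rewrite !tK.
Qed.

End Homomorphisms.

(** * Extending an object map [T] with a unit [eta] to a functor *)

Section UnitClosure.
Variables (V : variety) (T : algebra V -> algebra V).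
Variable eta : forall X, hom X (T X).

Inductive in_unit_closure : arrow V -> Prop :=
  | closure_iso (f : arrow V) :
      is_iso (f : variety_category V) -> in_unit_closure f
  | closure_unit X : in_unit_closure (Arrow (eta X))
  | closure_comp X Y Z (f : hom Y Z) (g : hom X Y) :
      in_unit_closure (Arrow f) -> in_unit_closure (Arrow g) ->
      in_unit_closure (Arrow (hom_comp f g)).

Definition unit_closure : subcategory (variety_category V).
Proof.
refine (@Subcategory (variety_category V) in_unit_closure _ _ _).
- by move=> f _; apply/closure_iso/is_iso_id.
- by move=> f _; apply/closure_iso/is_iso_id.
- move=> [Y Z f] [X Y' g] h fA gA E.
  have e : Y = Y' by have /(congr1 (@dom V)) := comp_srcs E.
  subst Y'; move: E; rewrite /= arrow_compE => /Some_inj <-.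
  exact: closure_comp.
Defined.

Hypothesis eta_surj : forall X, surjective (eta X).
Hypothesis eta_iso : forall X Y (f : hom X Y),
  is_iso (Arrow f : variety_category V) ->
  exists f' : hom (T X) (T Y), hom_comp f' (eta X) = hom_comp (eta Y) f.

(** By induction on generation. The lift of an isomorphism is inverted by the lift of its inverse,
    since [eta] is surjective; for [eta X] the square has [eta (T X)] on both sides. *)
Lemma closure_lift (f : arrow V) : in_unit_closure f ->
  exists f' : hom (T (dom f)) (T (cod f)),
    in_unit_closure (Arrow f') /\
    hom_comp f' (eta (dom f)) = hom_comp (eta (cod f)) (arr_hom f).
Proof.
elim=> {f} [[X Y f] f_iso|X|X Y Z f g _ [/= f' [f'A Ef]] _ [/= g' [g'A Eg]]].
- have [/= g [gf fg]] := (is_isoP f).1 f_iso.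
  have [f' Ef] := eta_iso f_iso.
  have [g' Eg] : exists g' : hom (T Y) (T X), hom_comp g' (eta Y) = hom_comp (eta X) g.
    by apply: eta_iso; apply/is_isoP; exists f.
  exists f'; split=> //; apply/closure_iso/is_isoP; exists g'.
  split; apply: surj_cancel (@eta_surj _) _; apply: hom_eq => x /=.
    have /= -> := hom_congr Ef x; have /= -> := hom_congr Eg (f x).
    by have /= -> := hom_congr gf x.
  have /= -> := hom_congr Eg x; have /= -> := hom_congr Ef (g x).
  by have /= -> := hom_congr fg x.
- by exists (eta (T X)); split=> //; exact: closure_unit.
- exists (hom_comp f' g'); split; first exact: closure_comp.
  apply: hom_eq => x /=.
  by have /= -> := hom_congr Eg x; have /= -> := hom_congr Ef (g x).
Qed.

Let A := unit_closure.

(** The choice is harmless: surjectivity of [eta] leaves only one lift. *)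
Definition lift_hom (f : A) : hom (T (dom (incl f))) (T (cod (incl f))) :=
  sval (cid (closure_lift (set_mem (valP f)))).

Lemma lift_hom_closure (f : A) : in_unit_closure (Arrow (lift_hom f)).
Proof. by rewrite /lift_hom; case: cid => ? []. Qed.

Lemma lift_homE (f : A) :
  hom_comp (lift_hom f) (eta _) = hom_comp (eta _) (arr_hom (incl f)).
Proof. by rewrite /lift_hom; case: cid => ? []. Qed.

Definition lift_mor (f : A) : A := SigSub (mem_set (lift_hom_closure f)).

(* Stated for arrows, so that no transport along equalities of objects is needed. *)
Lemma lift_mor_unique X Y (f : A) (g : hom X Y) (g' : hom (T X) (T Y)) :
  incl f = Arrow g -> hom_comp g' (eta X) = hom_comp (eta Y) g ->
  incl (lift_mor f) = Arrow g'.
Proof.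
move=> + Eg'; have -> : incl (lift_mor f) = Arrow (lift_hom f) by [].
move: (lift_hom f) (lift_homE f); case: (incl f) => D C h /= h' Eh' Eh.
have e1 : D = X by have /(congr1 (@dom V)) := Eh.
have e2 : C = Y by have /(congr1 (@cod V)) := Eh.
subst D C; move: Eh => /Arrow_inj Eh; subst h.
by congr Arrow; apply: surj_cancel (@eta_surj _) _; rewrite Eh' Eg'.
Qed.

(** Functoriality is uniqueness of lifts: identities and composites of lifts fill the required
    squares. *)
Definition unit_functor : functor A A.
Proof.
refine (@Functor A A lift_mor _ _ _).
- move=> f; apply/val_inj; apply: (lift_mor_unique (g := hom_id _)) => //.
  exact: hom_eq.
- move=> f; apply/val_inj; apply: (lift_mor_unique (g := hom_id _)) => //.
  exact: hom_eq.
- move=> f g h /incl_comp_eq E; apply/incl_comp_eq.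
  have -> : incl (lift_mor f) = Arrow (lift_hom f) by [].
  have -> : incl (lift_mor g) = Arrow (lift_hom g) by [].
  move: (lift_hom f) (lift_homE f) (lift_hom g) (lift_homE g).
  case: (incl f) (incl g) E => [Y Z f1] [X Y' g1] /= E.
  have e := arrow_comp_cod E; rewrite /= in e.
  subst Y'; move: E; rewrite arrow_compE => /Some_inj Eh f' Ef g' Eg.
  rewrite arrow_compE; congr Some; apply/esym.
  apply: (lift_mor_unique (g := hom_comp f1 g1)); first by rewrite Eh.
  apply: hom_eq => x /=.
  rewrite [g' _](hom_congr Eg x).
  exact: hom_congr Ef (g1 x).
Defined.

Definition unit_component (e : identities A) : A :=
  SigSub (mem_set (closure_unit (dom (incl (id_mor e))))) : A.

Definition unit_nat_trans : nat_trans (id_functor A) unit_functor.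
Proof.
refine (@NatTrans A A (id_functor A) unit_functor unit_component _ _ _).
- move=> e; rewrite -[in RHS](src_id_identity e); exact/val_inj.
- move=> e; apply/val_inj/esym.
  apply: (lift_mor_unique (g := hom_id _)); last exact: hom_eq.
  by have /(congr1 val) := set_mem (valP e).
- move=> f; rewrite -[LHS]/(comp _ f).
  (* In the ambient category, the naturality square is the equation defining the lift. *)
  apply: (inj_omap (@incl_inj _ A)); rewrite !incl_comp.
  have -> : incl (unit_functor f) = Arrow (lift_hom f) by [].
  have -> : incl (unit_component (tgt_id f)) = Arrow (eta (cod (incl f))) by [].
  have -> : incl (unit_component (src_id f)) = Arrow (eta (dom (incl f))) by [].
  move: (lift_hom f) (lift_homE f); case: (incl f) => X Y g /= g' E.
  by rewrite !arrow_compE E.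
Defined.

End UnitClosure.

(** * The unit attached to a characteristic quotient *)

Section CharacteristicUnit.
Variables (V : variety) (G Q : algebra V) (pi : hom G Q).

(* The pullbacks of [ker pi] along all isomorphisms [X -> G], intersected so as
   not to choose one; this is the total relation when [X] is not isomorphic to
   [G]. *)
Definition pullback_ker (X : algebra V) : congruence X.
Proof.
refine (@Congruence V X (fun x y => forall t : hom X G,
  is_iso (Arrow t : variety_category V) -> pi (t x) = pi (t y)) _ _ _ _) => //.
- by move=> x y E t /E.
- by move=> y x z E1 E2 t t_iso; rewrite E1 // E2.
- move=> o a b E t t_iso; rewrite !homM; congr aop.
  by apply/funext => i; exact: E.
Defined.

(* The case distinction makes the component at [G] equal to [pi] itself, rather
   than to an isomorphic quotient. *)
Definition ker_unit (X : algebra V) : {Y : algebra V & hom X Y} :=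
  match pselect (G = X) with
  | left e => eq_rect G (fun X => {Y : algebra V & hom X Y}) (existT _ Q pi) X e
  | right _ => existT _ (quot_algebra (pullback_ker X)) (quot_proj (pullback_ker X))
  end.

Lemma ker_unit_base : ker_unit G = existT _ Q pi.
Proof. by rewrite /ker_unit; case: pselect => // e; rewrite (Prop_irrelevance e erefl). Qed.

Lemma ker_unit_surj X : surjective pi -> surjective (projT2 (ker_unit X)).
Proof.
move=> pi_surj; rewrite /ker_unit; case: pselect => [e|_]; first by subst X.
by move=> c; exists (quot_repr c); exact: quot_reprK.
Qed.

(** The case to check is [X = G], where the isomorphisms are the automorphisms of [G]: each
    preserves the kernel of [pi], and the identity gives the other inclusion. *)
Lemma ker_unit_ker X : is_characteristic pi ->
  forall x y, projT2 (ker_unit X) x = projT2 (ker_unit X) y <-> pullback_ker X x y.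
Proof.
move=> pi_char x y; rewrite /ker_unit; case: pselect => [e|_]; last exact: quot_class_eq.
subst X => /=; split=> [E t /pi_char[psi _ Epsi]|/(_ _ (is_iso_id G))//].
have Et z : pi (t z) = psi (pi z) by exact: hom_congr (esym Epsi) z.
by rewrite !Et E.
Qed.

(** Precomposition with [f] sends isomorphisms from [Y] to [G] to isomorphisms from [X] to [G], so
    [f] respects the intersected kernels. *)
Lemma ker_unit_iso X Y (f : hom X Y) : surjective pi -> is_characteristic pi ->
  is_iso (Arrow f : variety_category V) ->
  exists f', hom_comp f' (projT2 (ker_unit X)) = hom_comp (projT2 (ker_unit Y)) f.
Proof.
move=> pi_surj pi_char f_iso; apply: surj_factor; first exact: ker_unit_surj.
move=> x x' /(ker_unit_ker pi_char) E; apply/(ker_unit_ker pi_char) => t t_iso.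
exact: (E (hom_comp t f) (is_iso_comp t_iso f_iso)).
Qed.

End CharacteristicUnit.

(** * Characteristicity from a unit or from a bimorphism *)

Section ConverseDirections.
Variables (V : variety) (G Q : algebra V) (pi : hom G Q).
Hypothesis pi_surj : surjective pi.

(** Naturality at [phi] says that [eps] at [G] followed by [U phi] equals [phi] followed by [eps],
    so [phi] preserves the kernel of [eps] at [G], which is that of [pi]. *)
Lemma characteristic_of_unit (A : subcategory (variety_category V))
    (U : functor A A) (eps : nat_trans (id_functor A) U) (idG : identities A) :
  (forall f : variety_category V, is_iso f -> sub_mor A f) ->
  incl (id_mor idG) = id_arrow G ->
  same_quotient (Arrow pi) (Arrow (coim_proj (arr_hom (incl (eps idG))))) ->
  is_characteristic pi.
Proof.
move=> isoA idGE sq; apply: characteristic_of_ker => // phi phi_aut.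
pose phiA : A := SigSub (mem_set (isoA _ phi_aut)).
have phiE : incl phiA = Arrow phi by [].
have := naturality eps phiA.
have -> : tgt_id phiA = idG by do 2!apply/val_inj; rewrite /= -idGE.
have -> : src_id phiA = idG by do 2!apply/val_inj; rewrite /= -idGE.
move=> /(congr1 (omap (@incl _ A))); rewrite !incl_comp [fmor _ _]/= phiE => nat.
have : src (incl (eps idG)) = id_arrow G.
  by rewrite -idGE; exact: (congr1 (@incl _ A) (src_component eps idG)).
move: sq nat; case: (incl (eps idG)) => X Y h sq nat /(congr1 (@dom V)) /= e.
subst X => x x'.
have kerE z z' : pi z = pi z' <-> h z = h z'.
  by rewrite (same_quotient_ker sq); exact: quot_class_eq.
(* The endpoints of [U phi] are recovered from the naturality equation itself. *)
move: nat; rewrite /= arrow_compE; case: (incl (U phiA)) => Y1 Z u /esym nat.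
have e := arrow_comp_cod nat; rewrite /= in e.
subst Y1; move: nat; rewrite arrow_compE => /Some_inj E.
have EZ : Z = Y by have /(congr1 (@cod V)) := E.
subst Z; move: E => /Arrow_inj E /kerE hx; apply/kerE.
have Ez z : h (phi z) = u (h z) by exact: hom_congr (esym E) z.
by rewrite !Ez hx.
Qed.

(** Every automorphism [phi] lies in [B], so [bimorphism_intertwines] gives [psi] with
    [psi pi = pi phi]. Whether [psi] is invertible is left to [characteristic_of_ker]. *)
Lemma characteristic_of_bimorphism (A B : subcategory (variety_category V))
    (cA : bicapsule A B A) (cB : bicapsule A B B) (M : A -> option B) (idG p : B) :
  (forall phi : hom G G, is_automorphism phi -> sub_mor B (Arrow phi)) ->
  incl idG = id_arrow G -> incl p = Arrow pi ->
  left_regular (bleft cA) -> right_regular (bright cB) -> bimorphism cA cB M ->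
  obind M (one_ract (bright cA) idG) = Some p ->
  is_characteristic pi.
Proof.
move=> autB idGE pE regA regB bimM Mp; apply: characteristic_of_ker => // phi phi_aut.
pose phiB : B := SigSub (mem_set (autB _ phi_aut)).
have [||psi] := bimorphism_intertwines (phi := phiB) regA regB bimM Mp.
- by apply/val_inj; rewrite /= -idGE.
- by apply/val_inj; rewrite /= -idGE.
move=> /(congr1 (omap (@incl _ B))); rewrite !incl_comp pE.
have -> : incl phiB = Arrow phi by [].
rewrite /= arrow_compE; case: (incl psi) => Y Z u E.
have e := arrow_comp_cod E; rewrite /= in e.
subst Y; move: E; rewrite arrow_compE => /Some_inj E.
have EZ : Z = Q by have /(congr1 (@cod V)) := E.
subst Z; move: E => /Arrow_inj E x x' pix.
have Ez z : pi (phi z) = u (pi z) by exact: hom_congr (esym E) z.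
by rewrite !Ez pix.
Qed.

End ConverseDirections.

Theorem mainTheorem5 (V : variety) (G Q : algebra V) (pi : hom G Q)
    (pi_surj : surjective pi) :
  exists A B : subcategory (variety_category V),
    (forall f : variety_category V, is_iso f -> sub_mor A f) /\
    (is_characteristic pi <->
      exists (U : functor A A) (eps : nat_trans (id_functor A) U)
             (idG : identities A),
        incl (id_mor idG) = id_arrow G /\
        same_quotient (Arrow pi) (Arrow (coim_proj (arr_hom (incl (eps idG)))))) /\
    (is_characteristic pi <->
      exists idG p : B,
        incl idG = id_arrow G /\ incl p = Arrow pi /\
        exists (cA : bicapsule A B A) (cB : bicapsule A B B) (M : A -> option B),
          left_regular (bleft cA) /\ right_regular (bright cB) /\
          bimorphism cA cB M /\
          obind M (one_ract (bright cA) idG) = Some p).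
Proof.
(* This closure makes sense for any [pi], so [A] is fixed before [pi] is assumed characteristic, as
   the order of quantifiers demands. *)
pose A := unit_closure (fun X => projT2 (ker_unit pi X)).
have isoA (f : variety_category V) : is_iso f -> sub_mor A f by exact: closure_iso.
have unit_pi : is_characteristic pi -> exists (U : functor A A)
    (eps : nat_trans (id_functor A) U) (idG : identities A),
    incl (id_mor idG) = id_arrow G /\ incl (eps idG) = Arrow pi.
  move=> pi_char.
  have eta_surj X : surjective (projT2 (ker_unit pi X)) by exact: ker_unit_surj.
  have eta_iso X Y (f : hom X Y) := ker_unit_iso (f := f) pi_surj pi_char.
  exists (unit_functor eta_surj eta_iso), (unit_nat_trans eta_surj eta_iso).
  pose g : A := SigSub (mem_set (isoA _ (is_iso_id G))).
  exists (src_id g); split; first by [].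
  by rewrite /incl /= ker_unit_base.
exists A, A; split; first by [].
split; split.
- move=> /unit_pi[U [eps [idG [idGE epsE]]]]; exists U, eps, idG; split=> //.
  by rewrite epsE; exact: same_quotient_coim.
- move=> [U [eps [idG [idGE sq]]]]; exact: characteristic_of_unit isoA idGE sq.
- move=> /unit_pi[U [eps [idG [idGE epsE]]]]; exists (id_mor idG), (eps idG).
  do 2!split=> //; exact: bimorphism_of_unit.
- move=> [idG [p [idGE [pE [cA [cB [M [regA [regB [bimM Mp]]]]]]]]]].
  by apply: (characteristic_of_bimorphism pi_surj _ idGE pE regA regB bimM Mp) => phi /isoA.
Qed.
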